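(* Let $S\colon D\to D'$ be a link cobordism represented as a movie of link diagrams, and let $\phi_S\colon\mathit{CKh}_{h,t}(D)\to\mathit{CKh}_{h,t}(D')$ be the corresponding cobordism map. Then \[ \widehat\sigma\circ\phi_S=\phi_S\circ\widehat\sigma \] as maps $\mathit{CKh}_{h,t}(D)\to\mathit{CKh}_{h,t}(D')$.
   Context: $R_{h,t}=\mathbb{Z}[h,t]$ is graded with $\deg h=2,\ \deg t=4$, and $A_{h,t}=R_{h,t}[X]/(X^2-hX-t)$ with $\deg X=2$. $A_{h,t}$ is a Frobenius $R_{h,t}$-algebra with the usual multiplication $m$ and unit $\iota$, counit $\epsilon(1)=0,\ \epsilon(X)=1$, and comultiplication $\Delta(1)=1\otimes X+X\otimes 1-h(1\otimes 1)$, $\Delta(X)=X\otimes X+t(1\otimes 1)$. For an oriented link diagram $D$ with $n$ crossings ($n_-$ negative), $\mathit{CKh}_{h,t}(D)$ is the Khovanov complex obtained from $A_{h,t}$: to each vertex $v\in\{0,1\}^n$ of the cube of resolutions, whose resolution consists of $k$ circles, one assigns $A_{h,t}^{\otimes k}$ (tensor over $R_{h,t}$), in homological degree $|v|-n_-$; the differential is the sum over edges of $\pm m$ or $\pm\Delta$ with the usual signs. The ring involutions $\widehat\sigma_0$ on $R_{h,t}$ and $\widehat\sigma_1$ on $A_{h,t}$ are determined by $\widehat\sigma_0(h)=-h$, $\widehat\sigma_0(t)=t$, $\widehat\sigma_1(X)=X-h$, $\widehat\sigma_1(rx)=\widehat\sigma_0(r)\widehat\sigma_1(x)$. The involution $\widehat\sigma$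 on $\mathit{CKh}_{h,t}(D)$ is $\widehat\sigma_1^{\otimes k}$ on each summand $A_{h,t}^{\otimes k}$; it is $\mathbb{Z}[h^2,t]$-linear. The cobordism map $\phi_S$ is Bar-Natan's (Khovanov's homology for tangles and cobordisms, 2005): the movie is decomposed into Reidemeister moves and Morse moves (birth, death, saddle); to Reidemeister moves are assigned Bar-Natan's explicit chain homotopy equivalences, whose components are integral linear combinations of undotted cobordisms, and to Morse moves the corresponding undotted elementary cobordisms, all evaluated by the TQFT of $A_{h,t}$. *)

(* Defs.v *)
From HB Require Import structures.
From mathcomp Require Export all_boot all_order all_algebra.
From mathcomp Require Export qpoly.
From mathcomp Require Export mpoly.
Set Implicit Arguments.
Unset Strict Implicit.
Unset Printing Implicit Defensive.
Import GRing.Theory.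
Local Open Scope ring_scope.

Definition Rht := {mpoly int[2]}.
Definition hR : Rht := 'X_ord0.
Definition tR : Rht := 'X_ord_max.

Definition Apol : {poly Rht} := 'X^2 - hR *: 'X - tR%:P.
Definition Aht := {poly %/ Apol}.

(* The R-basis (1, X) of A is indexed by [bool]: [false] is 1, [true] is X. *)
Definition bas (b : bool) : Aht := if b then in_qpoly Apol 'X else 1.
Definition coef (a : Aht) (b : bool) : Rht := (a : {poly Rht})`_b.

Definition counit (a : Aht) : Rht := coef a true.

(* A (x)_R A is the free R-module on the pairs of basis elements. *)
Definition AA := {ffun bool * bool -> Rht}.
Definition tens2 (a b : Aht) : AA := [ffun p => coef a p.1 * coef b p.2].
Definition scal2 (r : Rht) (z : AA) : AA := [ffun p => r * z p].

Definition comul (a : Aht) : AA :=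
    scal2 (coef a false)
      (tens2 (bas false) (bas true) + tens2 (bas true) (bas false)
        - scal2 hR (tens2 (bas false) (bas false)))
  + scal2 (coef a true)
      (tens2 (bas true) (bas true) + scal2 tR (tens2 (bas false) (bas false))).

Definition sigma0 (r : Rht) : Rht := r \mPo [tuple - hR; tR].
Definition sigma1 (a : Aht) : Aht :=
  in_qpoly Apol (map_poly sigma0 (a : {poly Rht}) \Po ('X - hR%:P)).

(* A planar diagram in general position with respect to the height function
   is a list of slices, read from bottom to top, each containing one cup
   (minimum), cap (maximum) or crossing; (g, i) puts g with its leftmost
   strand at position i (counted from 0) among the strands present, the other
   strands being vertical. Nesting and disjointness of components are thus
   recorded. [Cup o]: the left end is oriented upwards iff [o].
   [Cross b]: [b] iff the strand going from bottom left to top right is the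
   over-strand. *)
Inductive gen := Cup of bool | Cap | Cross of bool.
Definition slice := (gen * nat)%type.
Definition word := seq slice.

(* The orientations (true = upwards) of the strands after a slice, [None] if
   the slice does not fit. *)
Definition step (s : seq bool) (g : slice) : option (seq bool) :=
  let i := g.2 in
  match g.1 with
  | Cup o =>
      if (i <= size s)%N then Some (take i s ++ [:: o; ~~ o] ++ drop i s)
      else None
  | Cap =>
      if (i.+1 < size s)%N && (nth false s i != nth false s i.+1)
      then Some (take i s ++ drop i.+2 s) else None
  | Cross _ =>
      if (i.+1 < size s)%N
      then Some (take i s ++ [:: nth false s i.+1; nth false s i] ++ drop i.+2 s)
      else None
  end.

Definition run (D : word) : option (seq bool) :=
  foldl (fun s g => obind (step^~ g) s) (Some [::]) D.

Definition link_diagram (D : word) : Prop := run D = Some [::].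

Definition is_cross (g : slice) : bool := if g.1 is Cross _ then true else false.
Definition ncross (D : word) : nat := count is_cross D.

(* With both strands upwards [Cross true] is positive; reversing one strand
   changes the sign. *)
Definition negative_at (D : word) (k : nat) : bool :=
  match nth (Cap, 0%N) D k, run (take k D) with
  | (Cross b, i), Some s => b != (nth false s i == nth false s i.+1)
  | _, _ => false
  end.
Definition nminus (D : word) : nat := count (negative_at D) (iota 0 (size D)).

(* Slices of a crossingless diagram: [FTurn i] is a cap at i, i+1 below a
   cup at i, i+1; [FId] has only vertical strands. *)
Inductive flat := FCup of nat | FCap of nat | FTurn of nat | FId.

(* The 0-smoothing of a crossing joins the two regions swept by turning the
   over-strand counterclockwise. *)
Definition smoothing (b v : bool) (i : nat) : flat :=
  if v == ~~ b then FId else FTurn i.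

(* Crossings are ordered from bottom to top. *)
Fixpoint res (D : word) (v : seq bool) : seq flat :=
  match D with
  | [::] => [::]
  | (Cup _, i) :: D' => FCup i :: res D' v
  | (Cap, i) :: D' => FCap i :: res D' v
  | (Cross b, i) :: D' => smoothing b (head false v) i :: res D' (behead v)
  end.

Definition width_step (n : nat) (f : flat) : nat :=
  match f with FCup _ => n.+2 | FCap _ => n.-2 | _ => n end.
Definition width (W : seq flat) (j : nat) : nat :=
  foldl width_step 0%N (take j W).

(* (j, p) is the p-th point of the diagram on the horizontal line between
   the slices j-1 and j; it is present if p < width W j. *)
Definition pt (W : seq flat) := ('I_(size W).+1 * 'I_(size W).*2)%type.

(* Bottom point p of the slice is joined to its top point q. *)
Definition thru (f : flat) (p q : nat) : bool :=
  match f with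
  | FId => p == q
  | FCup i => q == if (p < i)%N then p else p.+2
  | FCap i => p == if (q < i)%N then q else q.+2
  | FTurn i => [&& p == q, p != i & p != i.+1]
  end.

(* Bottom points p, q of the slice are joined. *)
Definition capped (f : flat) (p q : nat) : bool :=
  match f with
  | FCap i | FTurn i => (p == i) && (q == i.+1)
  | _ => false
  end.

(* Top points p, q of the slice are joined. *)
Definition cupped (f : flat) (p q : nat) : bool :=
  match f with
  | FCup i | FTurn i => (p == i) && (q == i.+1)
  | _ => false
  end.

Definition arc (W : seq flat) (x y : pt W) : bool :=
  [|| (y.1 == x.1.+1 :> nat) && thru (nth FId W x.1) x.2 y.2,
      (x.1 == y.1) && capped (nth FId W x.1) x.2 y.2
    | [&& x.1 == y.1, (0 < x.1)%N & cupped (nth FId W x.1.-1) x.2 y.2]].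

Definition circles (W : seq flat) : {set {set pt W}} :=
  equivalence_partition (connect [rel x y | arc x y || arc y x])
    [set x : pt W | (x.2 < width W x.1)%N].
Definition circle (W : seq flat) := {c : {set pt W} | c \in circles W}.

(* A^{(x) k}, k the number of circles, is the free R-module on the maps
   circles -> {1, X}. *)
Definition basis (W : seq flat) := {ffun circle W -> bool}.
Definition tens (W : seq flat) := {ffun basis W -> Rht}.

(* The sigma0-semilinear map sigma1^{(x) k}. *)
Definition sigma_tens (W : seq flat) (a : tens W) : tens W :=
  [ffun y : basis W =>
     \sum_(x : basis W)
        sigma0 (a x) * \prod_(c : circle W) coef (sigma1 (bas (x c))) (y c)].

(* Matrix entry of the connected elementary cobordisms (identity, m, Delta,
   iota, epsilon) for the given labels of the incoming and outgoing circles.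
   The order in the lists is irrelevant as m and Delta are (co)commutative; the
   default case does not occur for planar diagrams. *)
Definition elementary (s s' : seq bool) : Rht :=
  match s, s' with
  | [:: x], [:: y] => (x == y)%:R
  | [:: x1; x2], [:: y] => coef (bas x1 * bas x2) y
  | [:: x], [:: y1; y2] => comul (bas x) (y1, y2)
  | [::], [:: y] => coef 1 y
  | [:: x], [::] => counit (bas x)
  | _, _ => 0
  end.

(* Two crossingless diagrams W, W' which differ only in that the l slices of
   W above height [a] are replaced by l' slices: the points at height <= a
   and >= a + l of W are points of W'. *)
Definition persists (alm : nat * nat * nat) (j j' : nat) : bool :=
  let: (a, l, l') := alm in
  ((j <= a) && (j' == j) || (a + l <= j) && (j' + l == j + l'))%N.

Definition meets alm (W W' : seq flat) (c : circle W) (c' : circle W') : bool :=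
  [exists x in val c, exists y in val c',
     (x.2 == y.2 :> nat) && persists alm x.1 y.1].

Definition adjacent alm (W W' : seq flat) :
    rel (circle W + circle W') := fun c c' =>
  match c, c' with
  | inl d, inr d' | inr d', inl d => meets alm d d'
  | _, _ => false
  end.

Definition components alm (W W' : seq flat) :
    {set {set circle W + circle W'}} :=
  equivalence_partition (connect (@adjacent alm W W')) [set: circle W + circle W'].

(* The map A^{(x) k} -> A^{(x) k'} of the cobordism W -> W' that is the product
   cobordism at the persisting points and each of whose components is a
   cylinder, a pair of pants or a disc. All the cobordisms below are
   compositions of these; the circles in the boundary of a component are
   exactly the ones linked by persisting points. *)
Definition cob (alm : nat * nat * nat) (W W' : seq flat) (a : tens W) : tens W' :=
  [ffun y : basis W' =>
     \sum_(x : basis W) a x *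
       \prod_(K in components alm W W')
          elementary [seq x c | c <- enum {: circle W} & inl c \in K]
                     [seq y c | c <- enum {: circle W'} & inr c \in K]].

(* The direct sum over all the vertices of the cube; the summand at v is in
   homological degree [hdeg v]. *)
Definition vertex (D : word) := (ncross D).-tuple bool.
Definition CKh (D : word) := {dffun forall v : vertex D, tens (res D v)}.

Definition weight (v : seq bool) : nat := count id v.
Definition hdeg (D : word) (v : vertex D) : int :=
  (weight v)%:Z - (nminus D)%:Z.

Definition clear (D : word) (v : vertex D) (k : 'I_(ncross D)) : vertex D :=
  [tuple tnth v i && (i != k) | i < ncross D].

Definition differential (D : word) (a : CKh D) : CKh D :=
  [ffun v : vertex D =>
     \sum_(k < ncross D | tnth v k)
        cob (0, 0, 0)%N (res D v) (a (clear v k)) *~ (-1) ^+ weight (take k v)].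

Definition sigma (D : word) (a : CKh D) : CKh D :=
  [ffun v : vertex D => sigma_tens (a v)].
Arguments sigma : clear implicits.

(* For the states vt of t and vt' of t', and the resolutions W and W' of
   u ++ t ++ w and u ++ t' ++ w, an entry of the matrix of cobordisms; the first
   argument is the height of t. *)
Definition kernel := nat -> seq bool -> seq bool ->
  forall W W' : seq flat, tens W -> tens W'.

(* The map given by the matrix K in the disc, the identity elsewhere. The
   Koszul sign accounts for the crossings above the disc. *)
Definition local_map (K : kernel) (u t t' w : word)
    (a : CKh (u ++ t ++ w)) : CKh (u ++ t' ++ w) :=
  let pre (v : seq bool) := take (ncross u) v in
  let mid n (v : seq bool) := take n (drop (ncross u) v) in
  let post n (v : seq bool) := drop (ncross u + n) v in
  [ffun v' : vertex (u ++ t' ++ w) =>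
     \sum_(v : vertex (u ++ t ++ w) |
             (pre v == pre v')
             && (post (ncross t) v == post (ncross t') v'))
       K (size u) (mid (ncross t) v) (mid (ncross t') v')
         (res (u ++ t ++ w) v) (res (u ++ t' ++ w) v') (a v)
       *~ (-1) ^+ ((weight (mid (ncross t) v) + weight (mid (ncross t') v'))
                   * weight (post (ncross t) v))].

(* No change of the local crossings: planar isotopies and Morse moves. *)
Definition K_plain (l l' : nat) : kernel := fun a v v' W W' x =>
  cob (a, l, l') W' x *~ (v == v')%:Z.

(* Exchange of two distant slices. *)
Definition K_swap : kernel := fun a v v' W W' x =>
  cob (a, 2, 2)%N W' x *~ (if v == [:: true; true] then -1 else 1)
                       *~ (v' == rev v)%:Z.

(* R1. The smoothing v = [:: b] of the kink is a circle and an arc. If b, the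
   complex of the kink is Delta : arc -> circle + arc, otherwise it is
   m : circle + arc -> arc. The slice [FTurn i] is at height a + o. *)
Definition K_R1 (b : bool) (o : nat) : kernel := fun a _ v' W W' x =>
  (if b then cob (a, 1, 2)%N W' x
   else cob (a + o, 0, 1)%N W' x
        - cob (a, 1, 2)%N W'
            (cob (a + o, 1, 0)%N W (cob (a + o, 0, 1)%N W' x)))
  *~ (v' == [:: b])%:Z.

Definition K_R1_inv (b : bool) (o : nat) : kernel := fun a v _ W W' x =>
  (if b then cob (a + o, 1, 0)%N W' x
        - cob (a + o, 1, 0)%N W'
            (cob (a + o, 0, 1)%N W (cob (a, 2, 1)%N W' x))
   else cob (a, 2, 1)%N W' x)
  *~ (v == [:: b])%:Z.

(* R2, for crossings [Cross b] below [Cross (~~ b)]. The state [:: ~~ b; b] is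
   the trivial tangle; [:: b; ~~ b] contains a circle, the matrix entry is
   then a saddle together with the birth or death of this circle. *)
Definition coef_R2 (b : bool) (e : int) (v : seq bool) : int :=
  if v == [:: ~~ b; b] then 1 else if v == [:: b; ~~ b] then e else 0.

Definition K_R2 (b : bool) : kernel := fun a _ v' W W' x =>
  cob (a, 0, 2)%N W' x *~ coef_R2 b 1 v'.
Definition K_R2_inv (b : bool) : kernel := fun a v _ W W' x =>
  cob (a, 2, 0)%N W' x *~ coef_R2 b (-1) v.

Definition replace_at (a : nat) (f W : seq flat) : seq flat :=
  take a W ++ f ++ drop (a + size f) W.

(* R3, from T = [Cross b; Cross c; Cross (~~ b)] at positions p, q, p to
   T' = [Cross (~~ b); Cross c; Cross b] at positions q, p, q, {p, q} = {i, i+1}.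
   Each side is the cone of the saddle Psi from the 0- to the 1-smoothing of
   the middle crossing. The layer (middle bit ~~ c) with vertical smoothing
   is R2-reducible, with inclusion F, retraction G and homotopy H,
   1 - F G = d H + H d; the other layers (middle bit c) are related by the
   planar isotopy tau. Replacing (b, p, q) by (~~ b, q, p) gives the inverse
   move. The map is F' G on the first layer, tau on the second,
   and - tau Psi H if c (then the reducible layer is the source of Psi),
   - H' Psi' tau otherwise. H is, up to sign, the death of the circle from the
   state with the circle to (0,0), and its birth from (1,1) to that state; the
   signs of the two components of the product agree. *)
Definition K_R3 (b c : bool) (T T' : word) : kernel := fun a v v' W W' x =>
  let outer (s : seq bool) := [:: nth false s 0; nth false s 2] in
  let with_mid (m : bool) (s : seq bool) := [:: nth false s 0; m; nth false s 2] in
  let sg : int := if c then 1 else -1 in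
  let is_H (b' : bool) s s' :=
    (s == [:: b'; ~~ b']) && (s' == [:: false; false])
    || (s == [:: true; true]) && (s' == [:: b'; ~~ b']) in
  match nth false v 1, nth false v' 1 with
  | false, true =>
      if c then
        let W1 := replace_at a (res T (with_mid false v')) W in
        let W2 := replace_at a (res T (with_mid true v')) W in
        - cob (a, 3, 3)%N W' (cob (0, 0, 0)%N W2 (cob (a, 3, 3)%N W1 x))
          *~ (is_H b (outer v) (outer v'))%:Z
      else
        let W1 := replace_at a (res T' (with_mid false v)) W in
        let W2 := replace_at a (res T' (with_mid true v)) W in
        cob (a, 3, 3)%N W' (cob (0, 0, 0)%N W2 (cob (a, 3, 3)%N W1 x))
          *~ (is_H (~~ b) (outer v) (outer v'))%:Z
  | true, false => 0
  | m, _ =>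
      if m == c then cob (a, 3, 3)%N W' x *~ (v == v')%:Z
      else
        let W0 := take a W ++ drop (a + 3) W in
        cob (a, 0, 3)%N W' (cob (a, 3, 0)%N W0 x)
          *~ (coef_R2 b (- sg) (outer v) * coef_R2 (~~ b) sg (outer v'))
  end.

Definition nin (g : gen) : nat := if g is Cup _ then 0 else 2.
Definition nout (g : gen) : nat := if g is Cap then 0 else 2.

(* Planar isotopies other than exchanges of distant slices. *)
Inductive isotopy : word -> word -> Type :=
| zigzag_r o i : isotopy [:: (Cup o, i); (Cap, i.+1)] [::]
| zigzag_l o i : isotopy [:: (Cup o, i.+1); (Cap, i)] [::]
| rotate_cup o b i :
    isotopy [:: (Cup o, i); (Cross b, i.+1)] [:: (Cup o, i.+1); (Cross (~~ b), i)]
| rotate_cap b i :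
    isotopy [:: (Cross b, i.+1); (Cap, i)] [:: (Cross (~~ b), i); (Cap, i.+1)].

(* The Reidemeister moves are in standard position: any other one is obtained
   from these by planar isotopies. *)
Inductive move : word -> word -> Type :=
| Isotopy t t' of isotopy t t' : move t t'
| Isotopy_inv t t' of isotopy t t' : move t' t
| Exchange g g' i j of (i <= j)%N :
    move [:: (g, i); (g', j + nout g)%N] [:: (g', j + nin g)%N; (g, i)]
| Exchange_inv g g' i j of (i <= j)%N :
    move [:: (g', j + nin g)%N; (g, i)] [:: (g, i); (g', j + nout g)%N]
| R1_cup o b i : move [:: (Cup o, i)] [:: (Cup (~~ o), i); (Cross b, i)]
| R1_cup_inv o b i : move [:: (Cup (~~ o), i); (Cross b, i)] [:: (Cup o, i)]
| R1_cap b i : move [:: (Cap, i)] [:: (Cross b, i); (Cap, i)]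
| R1_cap_inv b i : move [:: (Cross b, i); (Cap, i)] [:: (Cap, i)]
| R2 b i : move [::] [:: (Cross b, i); (Cross (~~ b), i)]
| R2_inv b i : move [:: (Cross b, i); (Cross (~~ b), i)] [::]
| R3 b c p q of (p == q.+1) || (q == p.+1) :
    move [:: (Cross b, p); (Cross c, q); (Cross (~~ b), p)]
         [:: (Cross (~~ b), q); (Cross c, p); (Cross b, q)]
| Birth o i : move [::] [:: (Cup o, i); (Cap, i)]
| Death o i : move [:: (Cup o, i); (Cap, i)] [::]
| Saddle o i : move [::] [:: (Cap, i); (Cup o, i)]
| Saddle_inv o i : move [:: (Cap, i); (Cup o, i)] [::].

Definition move_kernel t t' (M : move t t') : kernel :=
  match M with
  | Exchange _ _ _ _ _ | Exchange_inv _ _ _ _ _ => K_swap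
  | R1_cup _ b _ => K_R1 b 1
  | R1_cup_inv _ b _ => K_R1_inv b 1
  | R1_cap b _ => K_R1 b 0
  | R1_cap_inv b _ => K_R1_inv b 0
  | R2 b _ => K_R2 b
  | R2_inv b _ => K_R2_inv b
  | R3 b c _ _ _ => K_R3 b c t t'
  | _ => K_plain (size t) (size t')
  end.

(* The condition on [run] says that the move fits in the diagram and respects
   the orientations; in particular all the frames of a movie starting with a
   link diagram are link diagrams. *)
Inductive movie (D : word) : word -> Type :=
| Still : movie D D
| Then u t t' w of movie D (u ++ t ++ w) & move t t' & run (u ++ t) = run (u ++ t') :
    movie D (u ++ t' ++ w).

Fixpoint cobordism_map D D' (S : movie D D') : CKh D -> CKh D' :=
  match S in movie _ E return CKh D -> CKh E with
  | Still => id
  | Then u t t' w S' M _ =>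
      fun a => local_map (move_kernel M) t' (cobordism_map S' a)
  end.

(* Main.v *)
(* In the basis (1, X) the involution of A commutes with the unit, counit,
   multiplication and comultiplication, hence with every connected elementary
   cobordism. The matrix of a cobordism is the product over its components of
   such elementary matrices, and each circle lies in exactly one component;
   so the sum over all the labellings of the intermediate circles factors as a
   product over the components, which reduces the general case to the
   connected one. The chain maps are integral combinations of composites of
   these cobordisms, and the involution is additive. *)
From HB Require Import structures.
Require Import Defs.
From mathcomp Require Import all_boot all_order all_algebra.
From mathcomp Require Import ring.
Set Implicit Arguments.
Unset Strict Implicit.
Unset Printing Implicit Defensive.
Import GRing.Theory.
Local Open Scope ring_scope.

(** * Structure constants of $A_{h,t}$ and of its involution in the basis $(1,X)$ *)

HB.instance Definition _ :=
  GRing.RMorphism.copy sigma0 (comp_mpoly [tuple - hR; tR]).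

Lemma sigma0h : sigma0 hR = - hR.
Proof. by rewrite /sigma0 comp_mpolyXU. Qed.

Lemma sigma0t : sigma0 tR = tR.
Proof. by rewrite /sigma0 comp_mpolyXU. Qed.

Lemma size_Apol_tail : (size (- (hR *: 'X) - tR%:P : {poly Rht})%R < 3)%N.
Proof.
rewrite -opprD size_polyN; apply: leq_ltn_trans (size_polyD _ _) _.
rewrite gtn_max (leq_ltn_trans (size_scale_leq _ _)) ?size_polyX //.
by rewrite (leq_ltn_trans (size_polyC_leq1 _)).
Qed.

(** The quotient [{poly %/ Apol}] reduces modulo [mk_monic Apol], which falls back to ['X] unless
    its argument is monic and nonconstant. Here the fallback is excluded, so [Aht] is the intended
    algebra. *)
Lemma mk_monic_Apol : mk_monic Apol = Apol.
Proof.
have ltX : (size (- (hR *: 'X) - tR%:P : {poly Rht})%R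
            < size ('X^2 : {poly Rht}))%N.
  by rewrite size_polyXn size_Apol_tail.
rewrite /mk_monic /Apol -addrA size_polyDl // size_polyXn /=.
by rewrite monicE lead_coefDl // lead_coefXn eqxx.
Qed.

Lemma size_Apol : size Apol = 3.
Proof.
by rewrite /Apol -addrA size_polyDl size_polyXn // size_Apol_tail.
Qed.

Arguments bas : simpl never.

Lemma coef_1 b : coef 1 b = (~~ b)%:R.
Proof. by rewrite /coef coefC; case: b. Qed.

Lemma coef_X b : coef (bas true) b = b%:R.
Proof.
rewrite /coef /bas in_qpoly_small; first by rewrite coefX; case: b.
by rewrite mk_monic_Apol size_Apol size_polyX.
Qed.

Lemma coef_bas b b' : coef (bas b) b' = (b == b')%:R.
Proof. by case: b; rewrite ?coef_X ?coef_1; case: b'. Qed.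

Lemma coef_D a b x : coef (a + b) x = coef a x + coef b x.
Proof. by rewrite /coef poly_of_qpolyD coefD. Qed.

Lemma coef_Z r a x : coef (r *: a) x = r * coef a x.
Proof. by rewrite /coef poly_of_qpolyZ coefZ. Qed.

Lemma basXX : bas true * bas true = hR *: bas true + tR *: 1.
Proof.
have /eqP : in_qpoly Apol ('X^2 - (hR *: 'X + tR%:P)) = 0.
  apply: val_inj; rewrite opprD addrA -/Apol /= mk_monic_Apol.
  by rewrite Pdiv.RingMonic.rmodpp // -mk_monic_Apol monic_mk_monic.
rewrite linearB /= expr2 in_qpolyM subr_eq0 => /eqP ->.
by rewrite linearD linearZ /= -alg_polyC linearZ /= in_qpoly1.
Qed.

Lemma sigma1_1 : sigma1 1 = 1.
Proof. by rewrite /sigma1 rmorph1 comp_polyC in_qpoly1. Qed.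

Lemma sigma1_X : sigma1 (bas true) = bas true - hR *: 1.
Proof.
rewrite /sigma1 in_qpoly_small; last first.
  by rewrite mk_monic_Apol size_Apol size_polyX.
by rewrite map_polyX comp_polyX linearB /= -alg_polyC linearZ /= in_qpoly1.
Qed.

Definition sigma1_mx (b b' : bool) : Rht := coef (sigma1 (bas b)) b'.

Lemma sigma1_mxE b b' :
  sigma1_mx b b' = if b then (if b' then 1 else - hR) else (~~ b')%:R.
Proof.
rewrite /sigma1_mx; case: b; rewrite ?sigma1_1 ?coef_1 ?eqbF_neg //.
rewrite sigma1_X -scaleNr coef_D coef_Z coef_X coef_1.
by case: b'; rewrite /= ?mulr0 ?addr0 ?mulr1 ?add0r.
Qed.

Lemma coefM_bas x1 x2 y : coef (bas x1 * bas x2) y =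
  if x1 && x2 then (if y then hR else tR) else (x1 || x2 == y)%:R.
Proof.
case: x1 x2 => -[]; rewrite ?mul1r ?mulr1.
- by rewrite basXX coef_D !coef_Z coef_X coef_1;
    case: y; rewrite /= ?mulr0 ?mulr1 ?addr0 ?add0r.
- by rewrite coef_X; case: y.
- by rewrite coef_X; case: y.
- by rewrite coef_1; case: y.
Qed.

Lemma comul_bas x y1 y2 : comul (bas x) (y1, y2) =
  if x then (if y1 && y2 then 1 else if y1 || y2 then 0 else tR)
  else (if y1 && y2 then 0 else if y1 || y2 then 1 else - hR).
Proof.
rewrite /comul !ffunE /= !coef_X !coef_1.
case: x; rewrite ?coef_X ?coef_1 /=; case: y1; case: y2 => /=; ring.
Qed.

(** * Sums over labellings of circles *)

(** Lists make the sums split along concatenation, and expand by computation when [n] is a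
    numeral. *)
Fixpoint labels (n : nat) : seq (seq bool) :=
  if n is n'.+1 then [seq b :: s | b <- [:: false; true], s <- labels n']
  else [:: [::]].

Lemma labelsS n :
  labels n.+1 = [seq b :: s | b <- [:: false; true], s <- labels n].
Proof. by []. Qed.

Lemma mem_labels n s : (s \in labels n) = (size s == n).
Proof.
elim: n s => [|n IHn] [|b s] //; rewrite labelsS.
  by apply/negP => /allpairsP[[? ?] []].
rewrite eqSS -IHn; apply/allpairsP/idP => [[[b' s'] /= [_ ? [_ ->]]] //|s_n].
by exists (b, s); split=> //=; case: b.
Qed.

Lemma uniq_labels n : uniq (labels n).
Proof.
elim: n => // n IHn; rewrite labelsS; apply: allpairs_uniq => //.
by move=> -[b s] [b' s'] _ _ /= [-> ->].
Qed.

Section Labellings.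
Variable R : comNzRingType.

Lemma sum_labelsS n (F : seq bool -> R) :
  \sum_(s <- labels n.+1) F s =
  \sum_(s <- labels n) F (false :: s) + \sum_(s <- labels n) F (true :: s).
Proof. by rewrite /= cats0 big_cat !big_map. Qed.

Lemma sum_labels0 (F : seq bool -> R) : \sum_(s <- labels 0) F s = F [::].
Proof. exact: big_seq1. Qed.

Lemma sum_labels_cat m n (F : seq bool -> R) :
  \sum_(s <- labels (m + n)) F s =
  \sum_(s <- labels m) \sum_(s' <- labels n) F (s ++ s').
Proof.
elim: m F => [|m IHm] F; first by rewrite sum_labels0.
by rewrite addSn !sum_labelsS !IHm.
Qed.

(** As [l] lists each element of [T] once, reading the values along [l] is a bijection from
    functions to label lists. *)
Lemma sum_ffun_labels (T : finType) (l : seq T) (F : seq bool -> R) :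
  perm_eq l (enum T) ->
  \sum_(z : {ffun T -> bool}) F [seq z x | x <- l] =
  \sum_(s <- labels (size l)) F s.
Proof.
move=> lT; have l_all x : x \in l by rewrite (perm_mem lT) mem_enum.
have l_uniq : uniq l by rewrite (perm_uniq lT) enum_uniq.
rewrite -(big_map (fun z : {ffun T -> bool} => [seq z x | x <- l]) xpredT F).
apply: perm_big; apply: uniq_perm (uniq_labels _) _.
  rewrite map_inj_uniq ?index_enum_uniq // => z z' /eq_in_map eq_z.
  by apply/ffunP => x; apply: eq_z.
move=> s; rewrite mem_labels; apply/mapP/eqP => [[z _ ->]|sz_s].
  by rewrite size_map.
(* The inverse bijection; the default [false] is never reached, since every [x] is in [l] and [s] is
   as long as [l]. *)
exists [ffun x => nth false s (index x l)]; first exact: mem_index_enum.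
apply: (@eq_from_nth _ false) => [|i]; first by rewrite size_map.
rewrite sz_s => lt_i; have x0 : T by move: lt_i; case: (l).
by rewrite (nth_map x0) // ffunE index_uniq.
Qed.

(** Distributivity: a label list of the concatenation is an independent choice of one label list per
    block. [P] is known only through its recursion. *)
Lemma sum_labels_flatten (T I : Type) (r : seq I) (l : I -> seq T)
    (F : I -> seq bool -> R) (P : seq I -> seq bool -> R) :
  (P [::] [::] = 1) ->
  (forall i r' s s', size s = size (l i) ->
     P (i :: r') (s ++ s') = F i s * P r' s') ->
  \sum_(s <- labels (size (flatten [seq l i | i <- r]))) P r s =
  \prod_(i <- r) \sum_(s <- labels (size (l i))) F i s.
Proof.
move=> P0 PS; elim: r => [|i r IHr]; first by rewrite sum_labels0 big_nil.
rewrite big_cons /= size_cat sum_labels_cat big_distrl /= -IHr.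
rewrite big_seq [RHS]big_seq; apply: eq_bigr => s.
rewrite mem_labels => /eqP sz_s; rewrite big_distrr /=.
by apply: eq_bigr => s' _; apply: PS.
Qed.

Lemma sum_ffun_prod (T : finType) (I : Type) (r : seq I) (l : I -> seq T)
    (F : I -> seq bool -> R) :
  perm_eq (flatten [seq l i | i <- r]) (enum T) ->
  \sum_(z : {ffun T -> bool}) \prod_(i <- r) F i [seq z x | x <- l i] =
  \prod_(i <- r) \sum_(s <- labels (size (l i))) F i s.
Proof.
move=> rT.
(* [P] cuts [s] into consecutive blocks of the lengths of the [l i]; on the values of [z] these are
   the restrictions of [z] to the blocks. *)
pose P := fix P (r : seq I) (s : seq bool) : R := if r is i :: r' then
  F i (take (size (l i)) s) * P r' (drop (size (l i)) s) else 1.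
rewrite -(@sum_labels_flatten _ _ _ _ _ P) //; last first.
  by move=> i r' s s' /= <-; rewrite take_size_cat ?drop_size_cat.
rewrite -sum_ffun_labels //; apply: eq_bigr => z _; elim: (r) => [|i r' IHr].
  by rewrite big_nil.
rewrite big_cons IHr /= map_cat.
by rewrite take_size_cat ?drop_size_cat ?size_map.
Qed.

Lemma prod_cover (T : finType) (I : Type) (r : seq I) (l : I -> seq T)
    (F : T -> R) :
  perm_eq (flatten [seq l i | i <- r]) (enum T) ->
  \prod_(c : T) F c = \prod_(i <- r) \prod_(c <- l i) F c.
Proof.
by move=> rT; rewrite -big_enum -(perm_big _ rT) big_flatten big_map.
Qed.

End Labellings.

(** Used with [inl] and [inr]: the components of a cobordism distribute its incoming and its
    outgoing circles. The proof counts occurrences: [x] is listed only for the block containing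
    [g x]. *)
Lemma partition_preim_perm (T T' : finType) (g : T -> T') (P : {set {set T'}}) :
  partition P [set: T'] ->
  perm_eq (flatten [seq [seq c <- enum T | g c \in K] | K : {set T'} <- enum P])
    (enum T).
Proof.
case/and3P=> /eqP coverP trivP _; apply/allP => x _ /=.
rewrite count_flatten -map_comp sumnE big_map big_enum /=.
have xP : g x \in cover P by rewrite coverP.
rewrite [count _ (enum T)]count_uniq_mem ?enum_uniq // mem_enum inE.
have countE (K : {set T'}) :
    count (pred1 x) [seq c <- enum T | g c \in K] = (g x \in K).
  rewrite count_uniq_mem; last by rewrite filter_uniq ?enum_uniq.
  by rewrite mem_filter mem_enum inE andbT.
rewrite (bigD1 (pblock P (g x))) ?pblock_mem //= countE mem_pblock xP.
rewrite big1 // => K /andP[KP neqK]; rewrite countE.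
by apply/eqP; rewrite eqb0; apply: contra neqK => /(def_pblock trivP KP) ->.
Qed.

(** * Equivariance of connected cobordisms *)

(** Matrix entry of a tensor power of [sigma1]. The truncation in [zip] is harmless, as the lists
    have equal lengths in all uses. *)
Definition sigma1_mx_seq (s s' : seq bool) : Rht :=
  \prod_(p <- zip s s') sigma1_mx p.1 p.2.

Lemma elementary_eq0 s s' :
  (size s, size s')
    \notin [:: (1, 1); (2, 1); (1, 2); (0, 1); (1, 0)]%N ->
  elementary s s' = 0.
Proof. by case: s => [|? [|? [|? ?]]]; case: s' => [|? [|? [|? ?]]]. Qed.

(** Matrix form of the commutation with the involution; [sigma0] appears on one side only because
    the involution is semilinear and the cobordism map linear. *)
Lemma elementary_sigma s y :
  \sum_(z <- labels (size y)) sigma0 (elementary s z) * sigma1_mx_seq z y =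
  \sum_(u <- labels (size s)) sigma1_mx_seq s u * elementary u y.
Proof.
have [ok|no] := boolP ((size s, size y)
    \in [:: (1, 1); (2, 1); (1, 2); (0, 1); (1, 0)]%N); last first.
  rewrite big_seq [RHS]big_seq !big1 // => z; rewrite mem_labels => /eqP sz_z.
    by rewrite (@elementary_eq0 z) ?mulr0 ?sz_z.
  by rewrite (@elementary_eq0 s z) ?rmorph0 ?mul0r ?sz_z.
case: s y ok => [|x1 [|x2 [|? ?]]]; case=> [|y1 [|y2 [|? ?]]] // _;
  rewrite !(sum_labelsS, sum_labels0) /sigma1_mx_seq /= ?big_cons ?big_nil /=
    /counit !(sigma1_mxE, coef_bas, coef_1, coefM_bas, comul_bas) /=.
(* The remaining cases are, in order, unit, counit, identity, comultiplication and
   multiplication. *)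
- by rewrite rmorph_nat; case: y1; rewrite /=; ring.
- by rewrite rmorph_nat; case: x1; rewrite /=; ring.
- by rewrite !rmorph_nat; case: x1; case: y1; rewrite /=; ring.
- by case: x1; case: y1; case: y2;
    rewrite /= ?rmorphN ?rmorph0 ?rmorph1 /= ?sigma0h ?sigma0t; ring.
- by case: x1; case: x2; case: y1;
    rewrite /= ?rmorph0 ?rmorph1 /= ?sigma0h ?sigma0t; ring.
Qed.

(** * Equivariance of arbitrary cobordisms [cob] *)

Section SigmaCob.
Variables (alm : nat * nat * nat) (W W' : seq flat).

Lemma adjacent_sym : symmetric (@adjacent alm W W').
Proof. by case=> c [] c'. Qed.

Lemma components_partition :
  partition (components alm W W') [set: circle W + circle W'].
Proof.
apply/equivalence_partitionP => x y z _ _ _.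
split=> [|xy]; first exact: connect0.
exact: (same_connect (sym_connect_sym adjacent_sym) xy).
Qed.

Lemma sigma_cob (a : tens W) :
  sigma_tens (cob alm W' a) = cob alm W' (sigma_tens a).
Proof.
pose C := components alm W W'.
pose l (K : {set circle W + circle W'}) :=
  [seq c <- enum {: circle W} | inl c \in K].
pose l' (K : {set circle W + circle W'}) :=
  [seq c <- enum {: circle W'} | inr c \in K].
have lC : perm_eq (flatten [seq l K | K <- enum C]) (enum {: circle W}).
  exact: (partition_preim_perm inl components_partition).
have l'C : perm_eq (flatten [seq l' K | K <- enum C]) (enum {: circle W'}).
  exact: (partition_preim_perm inr components_partition).
apply/ffunP => y; rewrite !ffunE.
under eq_bigr => z _ do rewrite ffunE rmorph_sum big_distrl /=.
under [RHS]eq_bigr => u _ do rewrite ffunE big_distrl /=.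
(* With the incoming labelling [x] fixed, both sides are multiples of [sigma0 (a x)]; the
   intermediate labelling is [z], on [W'], on the left and [u], on [W], on the right. *)
rewrite exchange_big [RHS]exchange_big /=; apply: eq_bigr => x _.
under eq_bigr => z _ do rewrite rmorphM rmorph_prod -mulrA.
under [RHS]eq_bigr => u _ do rewrite -mulrA.
rewrite -!big_distrr /=; congr (_ * _).
under eq_bigr => z _ do rewrite (prod_cover _ l'C) -big_enum -big_split /=.
under [RHS]eq_bigr => u _ do rewrite (prod_cover _ lC) -big_enum -big_split /=.
have sigma1_mx_map (T : Type) (f g : T -> bool) (s : seq T) :
    \prod_(c <- s) coef (sigma1 (bas (f c))) (g c)
    = sigma1_mx_seq (map f s) (map g s).
  by rewrite /sigma1_mx_seq zip_map big_map.
pose F K z :=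
  sigma0 (elementary (map x (l K)) z) * sigma1_mx_seq z (map y (l' K)).
pose G K u :=
  sigma1_mx_seq (map x (l K)) u * elementary u (map y (l' K)).
transitivity (\prod_(K <- enum C) \sum_(z <- labels (size (l' K))) F K z).
  rewrite -(sum_ffun_prod F l'C).
  by apply: eq_bigr => z _; apply: eq_bigr => K _; rewrite sigma1_mx_map.
transitivity (\prod_(K <- enum C) \sum_(u <- labels (size (l K))) G K u).
  apply: eq_bigr => K _.
  by rewrite -(size_map y) elementary_sigma size_map.
rewrite -(sum_ffun_prod G lC).
by apply: eq_bigr => u _; apply: eq_bigr => K _; rewrite sigma1_mx_map.
Qed.

End SigmaCob.

(** * Equivariance of the maps of moves and movies *)

(** Additivity suffices below, since all the signs and coefficients in the kernels are integers. *)
Fact sigma_tens_is_zmod_morphism W : zmod_morphism (@sigma_tens W).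
Proof.
move=> a b; apply/ffunP => y; rewrite !ffunE -sumrB; apply: eq_bigr => x _.
by rewrite !ffunE rmorphB mulrBl.
Qed.

HB.instance Definition _ W :=
  GRing.isZmodMorphism.Build (tens W) (tens W) (@sigma_tens W)
    (@sigma_tens_is_zmod_morphism W).

Definition sigma_equivariant (K : kernel) := forall a v v' W W' (x : tens W),
  sigma_tens (K a v v' W W' x) = K a v v' W W' (sigma_tens x).

Lemma K_plain_sigma l l' : sigma_equivariant (K_plain l l').
Proof. by move=> *; rewrite /K_plain raddfMz /= sigma_cob. Qed.

Lemma K_swap_sigma : sigma_equivariant K_swap.
Proof. by move=> *; rewrite /K_swap !raddfMz /= sigma_cob. Qed.

Lemma K_R1_sigma b o : sigma_equivariant (K_R1 b o).
Proof.
move=> *; rewrite /K_R1 raddfMz; congr (_ *~ _).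
by case: b; rewrite ?raddfB /= !sigma_cob.
Qed.

Lemma K_R1_inv_sigma b o : sigma_equivariant (K_R1_inv b o).
Proof.
move=> *; rewrite /K_R1_inv raddfMz; congr (_ *~ _).
by case: b; rewrite ?raddfB /= !sigma_cob.
Qed.

Lemma K_R2_sigma b : sigma_equivariant (K_R2 b).
Proof. by move=> *; rewrite /K_R2 raddfMz /= sigma_cob. Qed.

Lemma K_R2_inv_sigma b : sigma_equivariant (K_R2_inv b).
Proof. by move=> *; rewrite /K_R2_inv raddfMz /= sigma_cob. Qed.

Lemma K_R3_sigma b c T T' : sigma_equivariant (K_R3 b c T T').
Proof.
move=> a v v' W W' x; rewrite /K_R3.
(* The middle bits and [c] select the branch of the kernel; each entry is zero or an integer
   multiple of a composite of maps [cob]. *)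
case: (nth false v 1); case: (nth false v' 1); case: c => /=;
  by rewrite ?raddf0 // raddfMz ?raddfN /= !sigma_cob.
Qed.

Lemma move_kernel_sigma t t' (M : move t t') :
  sigma_equivariant (move_kernel M).
Proof.
case: M => [? ? ?|? ? ?|? ? ? ? ?|? ? ? ? ?|? ? ?|? ? ?|? ?|? ?|? ?|? ?
  |? ? ? ? ?|? ?|? ?|? ?|? ?] /=; [exact: K_plain_sigma | exact: K_plain_sigma
  | exact: K_swap_sigma | exact: K_swap_sigma | exact: K_R1_sigma
  | exact: K_R1_inv_sigma | exact: K_R1_sigma | exact: K_R1_inv_sigma
  | exact: K_R2_sigma | exact: K_R2_inv_sigma | exact: K_R3_sigma
  | exact: K_plain_sigma ..].
Qed.

(** The involution preserves each summand of the cube, and the Koszul sign is an integer, so the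
    claim reduces to single matrix entries. *)
Lemma local_map_sigma (K : kernel) u t t' w (a : CKh (u ++ t ++ w)) :
  sigma_equivariant K ->
  sigma (u ++ t' ++ w) (local_map K t' a) = local_map K t' (sigma _ a).
Proof.
move=> K_sigma; apply/ffunP => v'; rewrite !ffunE raddf_sum.
by apply: eq_bigr => v _; rewrite ffunE raddfMz /= K_sigma.
Qed.

Theorem proposition1p9 (D D' : word) (hD : link_diagram D)
    (hD' : link_diagram D') (S : movie D D') :
  sigma D' \o cobordism_map S =1 cobordism_map S \o sigma D.
Proof.
(* Induction on the movie: its last move contributes the outermost [local_map]. *)
elim: S {hD'} => [|u t t' w S IHS M _] a //=.
rewrite local_map_sigma; last exact: move_kernel_sigma.
by congr (local_map _ _ _); apply: IHS.
Qed.
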